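(* There is an absolute constant $C>0$ such that the following holds. For every connected graph $G=(V,E)$ and any set $L$ of labels, there exists an efficient (polynomial-time) online prediction algorithm such that for every labeling $\ell:V\to L$ (unknown to the algorithm) and every query sequence $v_1,v_2,\ldots$ of vertices, the number of mistakes the algorithm makes, not counting the first query, is at most $C\log|V|\cdot|cut(\ell)|$, where $cut(\ell)=\{(u,v)\in E:\ell(u)\neq\ell(v)\}$.
   Context: Online prediction of graph labeling: in each round $i=1,2,\ldots$ an adversary asks for the label of a vertex $v_i\in V$; the algorithm outputs a predicted label $y_i\in L$ and then learns the true label $\ell(v_i)$. A mistake is a round $i$ with $y_i\neq\ell(v_i)$; the mistake on the first query $v_1$ is not counted. *)

(* Defs.v *)
From HB Require Import structures.
From mathcomp Require Import all_boot all_order all_algebra.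

Set Implicit Arguments.
Unset Strict Implicit.
Unset Printing Implicit Defensive.

Record sgraph := SGraph {
  vertex :> finType;
  adj : rel vertex;
  adj_sym : symmetric adj;
  adj_irrefl : irreflexive adj
}.

Definition connected_graph (G : sgraph) : Prop :=
  forall x y : G, connect (@adj G) x y.

(* An edge is an unordered pair, represented by the set of its two endpoints. *)
Definition cut (G : sgraph) (L : eqType) (l : G -> L) : {set {set G}} :=
  [set [set p.1; p.2] | p : G * G in
     [pred p : G * G | adj p.1 p.2 && (l p.1 != l p.2)]].

(* The model of computation is a random access machine, presented as a       *)
(* while-language over finitely many arrays (a program names only finitely   *)
(* many) of two kinds: arrays of natural numbers, and arrays of labels.      *)
(* Labels are opaque: a program can only copy them and test them for         *)
(* equality, so programs make sense over every label set. The input graph is *)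
(* read-only: its order, and its adjacency matrix, read one entry at a time. *)
(* There is no multiplication, so t unit-cost steps produce only numbers of  *)
(* O(t) bits beyond the input, and polynomially many steps is polynomial     *)
(* time in the usual sense.                                                  *)
Inductive expr :=
  | EConst of nat
  | EOrder
  | EAdj of expr & expr
  | EGet of nat & expr
  | EAdd of expr & expr
  | ESub of expr & expr
  | ESameLabel of nat & expr & nat & expr.

(* [CPut x i e] is x[i] := e on arrays of numbers, and [CCopy x i y j] is    *)
(* x[i] := y[j] on arrays of labels; conditions hold when nonzero.           *)
Inductive cmd :=
  | CSkip
  | CPut of nat & expr & expr
  | CCopy of nat & expr & nat & expr
  | CSeq of cmd & cmd
  | CIf of expr & cmd & cmd
  | CWhile of expr & cmd.

Record store (L : Type) := Store {
  nums : nat -> nat -> nat;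
  labs : nat -> nat -> L
}.

Definition upd (T : Type) (m : nat -> nat -> T) (x i : nat) (a : T) :
    nat -> nat -> T :=
  fun y j => if (y == x) && (j == i) then a else m y j.

Definition put_num (L : Type) (s : store L) (x i a : nat) : store L :=
  Store (upd (nums s) x i a) (labs s).

Definition put_lab (L : Type) (s : store L) (x i : nat) (a : L) : store L :=
  Store (nums s) (upd (labs s) x i a).

Section Semantics.

Variables (n : nat) (a : rel nat) (L : eqType).
Implicit Types (s : store L) (e : expr) (c : cmd).

Fixpoint eval s e : nat :=
  match e with
  | EConst k => k
  | EOrder => n
  | EAdj e1 e2 => a (eval s e1) (eval s e2)
  | EGet x i => nums s x (eval s i)
  | EAdd e1 e2 => eval s e1 + eval s e2
  | ESub e1 e2 => eval s e1 - eval s e2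
  | ESameLabel x i y j => labs s x (eval s i) == labs s y (eval s j)
  end.

(* A configuration is the list of commands still to be executed and a store. *)
(* One step executes one assignment, evaluates one condition, or unfolds one *)
(* sequence; as expressions have a size fixed by the program, this is a      *)
(* bounded number of machine operations.                                     *)
Definition step (k : seq cmd * store L) : seq cmd * store L :=
  let: (cs, s) := k in
  match cs with
  | [::] => ([::], s)
  | CSkip :: cs => (cs, s)
  | CPut x i e :: cs => (cs, put_num s x (eval s i) (eval s e))
  | CCopy x i y j :: cs => (cs, put_lab s x (eval s i) (labs s y (eval s j)))
  | CSeq c1 c2 :: cs => (c1 :: c2 :: cs, s)
  | CIf e c1 c2 :: cs => ((if eval s e == 0 then c2 else c1) :: cs, s)
  | CWhile e c :: cs =>
      (if eval s e == 0 then cs else c :: CWhile e c :: cs, s)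
  end.

Definition halts_within (B : nat) c s s' : Prop :=
  iter B step ([:: c], s) = ([::], s').

End Semantics.

Arguments step n a {L} k.

(* Vertices are presented to programs as the numbers 0, ..., |V| - 1. *)
Definition vnum (G : sgraph) (x : G) : nat := enum_rank x.

Definition adjn (G : sgraph) : rel nat := fun i j =>
  [exists x : G, exists y : G, [&& adj x y, vnum x == i & vnum y == j]].

Definition exec (G : sgraph) (L : eqType) (B : nat) (c : cmd)
    (s s' : store L) : Prop :=
  halts_within #|G| (adjn G) B c s s'.

(* [init] runs once, on the graph alone; in each round [predict] runs once   *)
(* the query is known, and [update] once its true label is known. The store  *)
(* persists throughout.                                                      *)
Record algorithm := Algorithm {
  init : cmd;
  predict : cmd;
  update : cmd
}.

(* The query is received in cell 0 of the number array 0, the true label in  *)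
(* cell 0 of the label array 0; the prediction is left in cell 0 of the      *)
(* label array 1.                                                            *)
Definition ask (G : sgraph) (L : Type) (x : G) (s : store L) : store L :=
  put_num s 0 0 (vnum x).

Definition reveal (L : Type) (a : L) (s : store L) : store L :=
  put_lab s 0 0 a.

Definition prediction (L : Type) (s : store L) : L := labs s 1 0.

(* Label cells initially hold an arbitrary label l0, since the first         *)
(* prediction has to be made before any label has been seen.                 *)
Definition initial_store (L : Type) (l0 : L) : store L :=
  Store (fun _ _ => 0) (fun _ _ => l0).

(* [session A l0 l B vs ys s]: on the labeling l, A answers the queries vs,  *)
(* in this order, by the predictions ys and ends in the store s, each run of *)
(* init, predict and update taking at most B steps.                          *)
Inductive session (G : sgraph) (L : eqType) (A : algorithm) (l0 : L)
    (l : G -> L) (B : nat) : seq G -> seq L -> store L -> Prop :=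
  | session_init s :
      exec G B (init A) (initial_store l0) s ->
      session A l0 l B [::] [::] s
  | session_round vs ys s v s1 s2 :
      session A l0 l B vs ys s ->
      exec G B (predict A) (ask v s) s1 ->
      exec G B (update A) (reveal (l v) s1) s2 ->
      session A l0 l B (rcons vs v) (rcons ys (prediction s1)) s2.

Definition answers (G : sgraph) (L : eqType) (A : algorithm) (l0 : L)
    (l : G -> L) (vs : seq G) (ys : seq L) : Prop :=
  exists B s, session A l0 l B vs ys s.

Definition polynomial_time (A : algorithm) : Prop :=
  exists p : {poly nat},
    forall G : sgraph, connected_graph G ->
    forall (L : eqType) (l0 : L) (l : G -> L) (vs : seq G),
    exists ys s, session A l0 l (p.[#|G|])%R vs ys s.

(* The mistake on the first query is not counted. *)
Definition mistakes (G : sgraph) (L : eqType) (l : G -> L)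
    (vs : seq G) (ys : seq L) : nat :=
  count (fun q : L * L => q.1 != q.2) (behead (zip ys [seq l v | v <- vs])).

(* Main.v *)
Require Import Defs.
From mathcomp Require Import all_boot all_order all_algebra.
From mathcomp Require Import reals exp.
From mathcomp Require Import zify ring.

(* The vertices are arranged in a linear order, built by repeatedly inserting
   a new vertex immediately after one of its neighbours u. Inserting w after u
   adds at most two label changes along the order, and none unless the edge uw
   is cut; as different insertions use different edges, the order has at most
   2 |cut| label changes. The algorithm predicts the label of the queried
   vertex nearest in this order. A wrong prediction for v from x is charged to
   a label change between x and v: since x is nearest, the gap between the
   closest queried vertices around that change is at least halved, so that each
   change is charged O(log |V|) times. *)

Set Implicit Arguments.
Unset Strict Implicit.
Unset Printing Implicit Defensive.

(** * Timed weakest preconditions *)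

Section Runs.

Variables (n : nat) (a : rel nat) (L : eqType).
Implicit Types (s : store L) (e : expr) (c : cmd) (Q : store L -> Prop).

(** The pending commands [cs] are arbitrary, so runs compose under sequencing; the exact time [t] is
    existential, so termination is included. *)
Definition runs (T : nat) c Q s : Prop :=
  exists s' t, [/\ t <= T, Q s' &
    forall cs, iter t (step n a) (c :: cs, s) = (cs, s')].

Lemma runs_mono T T' c Q Q' s :
  runs T c Q s -> T <= T' -> (forall s', Q s' -> Q' s') -> runs T' c Q' s.
Proof.
move=> [s' [t [le_tT Qs' run_c]]] leTT' QQ'; exists s', t; split=> //.
  exact: leq_trans leTT'.
exact: QQ'.
Qed.

Lemma runs_leq T T' c Q s : T <= T' -> runs T c Q s -> runs T' c Q s.
Proof. by move=> leTT' run_c; apply: runs_mono run_c leTT' _. Qed.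

Lemma runs_skip Q s : Q s -> runs 1 CSkip Q s.
Proof. by move=> Qs; exists s, 1. Qed.

Lemma runs_put x i e Q s :
  Q (put_num s x (eval n a s i) (eval n a s e)) -> runs 1 (CPut x i e) Q s.
Proof. by move=> Qs; eexists; exists 1; split; last by []. Qed.

Lemma runs_copy x i y j Q s :
  Q (put_lab s x (eval n a s i) (labs s y (eval n a s j))) ->
  runs 1 (CCopy x i y j) Q s.
Proof. by move=> Qs; eexists; exists 1; split; last by []. Qed.

Lemma runs_seq T1 T2 c1 c2 Q s :
  runs T1 c1 (runs T2 c2 Q) s -> runs (T1 + T2).+1 (CSeq c1 c2) Q s.
Proof.
move=> [s1 [t1 [le1 [s2 [t2 [le2 Qs2 run2]]] run1]]].
exists s2, (t2 + t1).+1; split=> // [|cs]; first by lia.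
by rewrite iterSr iterD /= run1 run2.
Qed.

Lemma runs_if T e c1 c2 Q s :
  (eval n a s e != 0 -> runs T c1 Q s) ->
  (eval n a s e = 0 -> runs T c2 Q s) -> runs T.+1 (CIf e c1 c2) Q s.
Proof.
move=> run1 run2.
have : runs T (if eval n a s e == 0 then c2 else c1) Q s.
  by case: eqP => [/run2|/eqP/run1].
move=> [s' [t [le_t Qs' run_c]]]; exists s', t.+1; split=> // cs.
by rewrite iterSr /= run_c.
Qed.

Definition cell (x : nat) : expr := EGet x (EConst 0).

Definition incr (x : nat) (i : expr) : cmd :=
  CPut x i (EAdd (EGet x i) (EConst 1)).

Definition for_loop (x : nat) c : cmd :=
  CSeq (CPut x (EConst 0) (EConst 0))
       (CWhile (ESub EOrder (cell x)) (CSeq c (incr x (EConst 0)))).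

(** An iteration costs one test, one unfolding, the body and one increment; the final 3 counts the
    outer unfolding, the initialisation and the failing test. *)
Lemma runs_for (I : nat -> store L -> Prop) T x c Q s :
  I 0 (put_num s x 0 0) ->
  (forall i s', i < n -> nums s' x 0 = i -> I i s' ->
     runs T c (fun s'' => nums s'' x 0 = i /\ I i.+1 (put_num s'' x 0 i.+1))
       s') ->
  (forall s', I n s' -> Q s') ->
  runs (n * (T + 3) + 3) (for_loop x c) Q s.
Proof.
rewrite /for_loop => I0 IS IQ; set w := CWhile _ _.
suff loop m i s' : m = n - i -> i <= n -> nums s' x 0 = i -> I i s' ->
    runs (m * (T + 3) + 1) w Q s'.
  apply: (@runs_leq (1 + (n * (T + 3) + 1)).+1); first by lia.
  apply: runs_seq; apply: runs_put; apply: (loop n 0) => //.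
    by rewrite subn0.
  by rewrite /= /upd !eqxx.
elim: m i s' => [|m IHm] i s' def_m le_in def_i Ii.
  exists s', 1; split=> // [|cs]; last by rewrite /= def_i -def_m.
  by apply: IQ; have <- : i = n by lia.
have [|s1 [t1 [le1 [i1 I1] run1]]] := IS i s' _ def_i Ii; first by lia.
have [] := IHm i.+1 (put_num s1 x 0 i.+1) _ _ _ I1.
- lia.
- lia.
- by rewrite /= /upd !eqxx.
move=> s2 [t2 [le2 Qs2 run2]].
exists s2, (t2 + (1 + (t1 + 2))); split=> // [|cs]; first by lia.
rewrite 3!iterD.
have -> : iter 2 (step n a) (w :: cs, s') =
    (c :: incr x (EConst 0) :: w :: cs, s') by rewrite /= def_i -def_m.
by rewrite run1 /= i1 addn1 run2.
Qed.

Lemma runs_halts T B c Q s : T <= B -> runs T c Q s ->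
  exists2 s', halts_within n a B c s s' & Q s'.
Proof.
move=> le_TB [s' [t [/leq_trans/(_ le_TB) le_tB Qs' run_c]]]; exists s' => //.
(* The steps left over idle on the empty command list. *)
rewrite /halts_within -(subnK le_tB) iterD run_c.
by elim: (B - t) => //= k ->.
Qed.

Lemma halts_within_inj B B' c s s1 s2 :
  halts_within n a B c s s1 -> halts_within n a B' c s s2 -> s1 = s2.
Proof.
have idle k s' : iter k (step n a) ([::], s') = ([::], s').
  by elim: k => //= k ->.
have mono k k' u u' : k <= k' -> halts_within n a k c s u ->
    halts_within n a k' c s u' -> u = u'.
  move=> le_kk' Hu; rewrite /halts_within -(subnK le_kk') iterD Hu idle.
  by case.
move=> H1 H2; case: (leqP B B') => [|/ltnW] le; [|symmetry].
  exact: mono le H1 H2.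
exact: mono le H2 H1.
Qed.

End Runs.

(** Execution is deterministic, so a bound proved for one constructed session holds for every
    session on the same queries, whatever its step budget. *)
Lemma session_inj (G : sgraph) (L : eqType) A (l0 : L) (l : G -> L) B B'
    vs ys ys' s s' :
  session A l0 l B vs ys s -> session A l0 l B' vs ys' s' ->
  ys = ys' /\ s = s'.
Proof.
move=> ses; elim: ses ys' s' => {vs ys s} [s run|vs ys s v s1 s2 _ IH p1 u1].
  move=> ys' s'; move E: [::] => ws ses.
  case: ws ys' s' / ses E => [s' run' _|vs ys s' v s1 s2 _ _ _].
    by split=> //; apply: halts_within_inj run run'.
  by move/(congr1 size); rewrite size_rcons.
move=> ys' s'; move E: (rcons _ _) => ws ses.
case: ws ys' s' / ses E => [s' _|vs' ys' s' v' s1' s2' ses' p2 u2].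
  by move/(congr1 size); rewrite size_rcons.
case/rcons_inj=> Evs Ev; subst.
have [Eys Es] := IH _ _ ses'; subst.
have Es1 := halts_within_inj p1 p2; subst.
by split=> //; apply: halts_within_inj u1 u2.
Qed.

(** * Label changes along a linear order *)

Section Changes.

Variables (T L : eqType) (f : T -> L).

Definition changes (s : seq T) : nat :=
  if s is x :: t then count id (pairmap (fun y z => f y != f z) x t) else 0.

(** The step from [u] to its successor becomes two steps through [w]; if [w] has the label of [u],
    the first is no change and the second counts as the old one. *)
Lemma changes_insert s1 u w s2 :
  changes (s1 ++ u :: w :: s2) <= changes (s1 ++ u :: s2) + (f u != f w).*2.
Proof.
have ins : count id (pairmap (fun y z => f y != f z) u (w :: s2)) <=
    count id (pairmap (fun y z => f y != f z) u s2) + (f u != f w).*2.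
  case: s2 => [|y s2] /=; first by lia.
  by case: (f u =P f w) => [->|_] /=; lia.
case: s1 => [|x s1] //; rewrite /= !pairmap_cat !count_cat.
by rewrite -addnA leq_add2l /= -addnA leq_add2l.
Qed.

Lemma changesE l0 s :
  changes s = \sum_(j < (size s).-1)
    (nth l0 (map f s) j != nth l0 (map f s) j.+1).
Proof.
case: s => [|x s] /=; first by rewrite big_ord0.
elim: s x => [|y s IHs] x /=; first by rewrite big_ord0.
by rewrite big_ord_recl IHs.
Qed.

Definition rank (s : seq T) (x : T) : nat :=
  if x \in s then (index x s).+1 else 0.

Lemma rank_gt0 s x : (0 < rank s x) = (x \in s).
Proof. by rewrite /rank; case: ifP. Qed.

(** Absent elements have rank 0, never above [r u], so [make_room] can shift by comparing ranks
    alone. *)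
Lemma rank_insert s1 u w s2 y :
  uniq (s1 ++ u :: s2) -> w \notin s1 ++ u :: s2 ->
  let r := rank (s1 ++ u :: s2) in
  rank (s1 ++ u :: w :: s2) y = if y == w then (r u).+1 else r y + (r u < r y).
Proof.
move=> Us Nw r.
have /andP[Nu1 Nu2] : (u \notin s1) && (u \notin s2).
  move: Us; rewrite cat_uniq /= => /and3P[_ /norP[Nu1 _] /andP[Nu2 _]].
  by rewrite Nu1 Nu2.
have ru : r u = (size s1).+1.
  by rewrite /r /rank mem_cat inE eqxx orbT index_cat (negPf Nu1) /= eqxx addn0.
rewrite ru; move: Nw; rewrite mem_cat inE !negb_or => /and3P[Nw1 Nwu Nw2].
rewrite /r /rank !mem_cat !inE !index_cat /=.
case: (y =P w) => [->|/eqP Nyw] /=.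
  by rewrite (negPf Nw1) (negPf Nwu) (eq_sym u) (negPf Nwu) eqxx /=; lia.
case y1: (y \in s1) => /=.
  by have := index_mem y s1; rewrite y1; lia.
rewrite (eq_sym u) (eq_sym w) (negPf Nyw).
by case: (y =P u) => [_|_] /=; [lia | case: (y \in s2) => /=; lia].
Qed.

End Changes.

Lemma change_between (L : eqType) (f : nat -> L) a b :
  a <= b -> f a != f b -> exists2 j, a <= j < b & f j != f j.+1.
Proof.
move/subnKC <-; elim: (b - a) => [|m IHm]; first by rewrite addn0 eqxx.
case: (f a =P f (a + m)) => [->|/eqP/IHm[j aj fj] _].
  by rewrite addnS => ?; exists (a + m) => //; lia.
by exists j => //; lia.
Qed.

(** * Charging the mistakes of the nearest neighbour rule *)

Section Charge.

Variables (T L : eqType) (n : nat) (pos : T -> nat) (f : nat -> L).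
Hypothesis pos_lt : forall x, pos x < n.

(** Subtraction is truncated, so this is the absolute difference. *)
Definition gap (x y : T) : nat := (pos x - pos y) + (pos y - pos x).

(* [c j] counts the mistakes charged to the change between positions [j] and
   [j.+1]; each of them halves the distance between the closest queries on
   both sides of it. *)
Definition charged (vs : seq T) (m : nat) : Prop :=
  exists c : nat -> nat,
    m <= \sum_(j < n.-1) (f j != f j.+1) * c j /\
    forall j, c j = 0 \/ exists a b,
      [/\ a \in vs, b \in vs, pos a <= j < pos b &
          (pos b - pos a) * 2 ^ c j <= n.*2].

Lemma charged_start vs : charged vs 0.
Proof. by exists (fun=> 0); split=> [|j]; [|left]. Qed.

Lemma charged_sub vs vs' m : {subset vs <= vs'} -> charged vs m ->
  charged vs' m.
Proof.
move=> sub [c [le_m Hc]]; exists c; split=> // j.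
case: (Hc j) => [|[a [b [va vb]]]]; [by left | right].
by exists a, b; split=> //; apply: sub.
Qed.

Lemma charged_mistake vs vs' m v x :
  {subset vs <= vs'} -> v \in vs' ->
  x \in vs -> (forall y, y \in vs -> gap v x <= gap v y) ->
  f (pos x) != f (pos v) -> charged vs m -> charged vs' m.+1.
Proof.
rewrite /gap => sub v' xs near neq [c [le_m Hc]].
have [j jlt fj] : exists2 j,
    minn (pos x) (pos v) <= j < maxn (pos x) (pos v) & f j != f j.+1.
  by apply: change_between; [lia | case: (leqP (pos x)); rewrite // eq_sym].
have px := pos_lt x; have pv := pos_lt v.
have jn : j < n.-1 by lia.
exists (fun i => c i + (i == j)); split=> [|i].
  under eq_bigr do rewrite mulnDr.
  rewrite big_split /= -addn1 leq_add //.
  by rewrite (bigD1 (Ordinal jn)) //= fj eqxx.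
have [->{i}|_] := eqVneq i j; last first.
  rewrite addn0; case: (Hc i) => [|[a [b [va vb]]]]; [by left | right].
  by exists a, b; split=> //; apply: sub.
right; have x' := sub _ xs; rewrite addn1 expnS.
have [lt_xv|le_vx] := ltnP (pos x) (pos v).
  exists x, v; split=> //; first by lia.
  (* A first charge fits because two positions differ by less than [n]; hence the bound [n.*2]. *)
  case: (Hc j) => [->|[a [b [va vb ajb le_ab]]]]; first by lia.
  (* Were [b] at or before [v], it would be nearer to [v] than [x] is. So [v] lies between [a] and
     [b], whose distances from [v] sum to their gap and are each at least that of [x]. *)
  apply: leq_trans le_ab; rewrite mulnA leq_mul2r; apply/orP; right.
  by have := near _ va; have := near _ vb; lia.
exists v, x; split=> //; first by lia.
case: (Hc j) => [->|[a [b [va vb ajb le_ab]]]]; first by lia.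
apply: leq_trans le_ab; rewrite mulnA leq_mul2r; apply/orP; right.
by have := near _ va; have := near _ vb; lia.
Qed.

(** The witnesses around a change have distinct positions, so their gap is at least 1 and
    [2 ^ c j <= n.*2]. *)
Lemma charged_bound vs m : charged vs m ->
  m <= (\sum_(j < n.-1) (f j != f j.+1)) * trunc_log 2 n.*2.
Proof.
move=> [c [le_m Hc]]; apply: leq_trans le_m _; rewrite big_distrl /=.
apply: leq_sum => j _; rewrite leq_mul2l; apply/orP; right.
case: (Hc j) => [->//|[a [b [_ _ ajb le_ab]]]].
apply: trunc_log_max => //; apply: leq_trans le_ab.
by rewrite leq_pmull //; lia.
Qed.

End Charge.

(** * The program *)

(* Number arrays: 1 holds the rank of each vertex in the linear order, counted
   from 1, or 0 while it is not placed; 2 flags the queried vertices; 3 to 6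
   are loop counters; 7 holds the smallest distance found so far. Label array 2
   holds the labels of the queried vertices. *)
Definition make_room : cmd :=
  for_loop 6 (CIf (ESub (EGet 1 (cell 6)) (EGet 1 (cell 4)))
                  (incr 1 (cell 6)) CSkip).

Definition insert_after : cmd :=
  CSeq make_room (CPut 1 (cell 5) (EAdd (EGet 1 (cell 4)) (EConst 1))).

Definition try_insert : cmd :=
  CIf (EAdj (cell 4) (cell 5))
      (CIf (EGet 1 (cell 4)) (CIf (EGet 1 (cell 5)) CSkip insert_after) CSkip)
      CSkip.

Definition sweep : cmd := for_loop 4 (for_loop 5 try_insert).

(** Vertex number 0 starts the order; by connectedness [|V|] sweeps place all the others. *)
Definition build_order : cmd :=
  CSeq (CPut 1 (EConst 0) (EConst 1)) (for_loop 3 sweep).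

Definition distance : expr :=
  EAdd (ESub (EGet 1 (cell 0)) (EGet 1 (cell 6)))
       (ESub (EGet 1 (cell 6)) (EGet 1 (cell 0))).

(** The initial [|V|] exceeds every distance in the order and stands for infinity. *)
Definition nearest_label : cmd :=
  CSeq (CPut 7 (EConst 0) EOrder)
       (for_loop 6
          (CIf (EGet 2 (cell 6))
               (CIf (ESub (cell 7) distance)
                    (CSeq (CPut 7 (EConst 0) distance)
                          (CCopy 1 (EConst 0) 2 (cell 6)))
                    CSkip)
               CSkip)).

Definition record_label : cmd :=
  CSeq (CCopy 2 (cell 0) 0 (EConst 0)) (CPut 2 (cell 0) (EConst 1)).

Definition nearest_neighbour : algorithm :=
  Algorithm build_order nearest_label record_label.

(** * Correctness and running time of building the order *)

Lemma size_full_uniq (T : finType) (s : seq T) :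
  uniq s -> (forall x, x \in s) -> size s = #|T|.
Proof. by move=> /card_uniqP <- all_s; apply: eq_card => x; rewrite all_s. Qed.

Section Correctness.

Variables (G : sgraph) (L : eqType) (l : G -> L).
Implicit Types (s : seq G) (st : store L).

Local Notation runsG := (@runs #|G| (adjn G) L).

Lemma vnum_inj : injective (@vnum G).
Proof. by move=> x y /val_inj/enum_rank_inj. Qed.

Lemma vnum_lt (x : G) : vnum x < #|G|.
Proof. exact: ltn_ord. Qed.

Lemma vnum_surj i : i < #|G| -> exists x : G, vnum x = i.
Proof.
by move=> lt_i; exists (enum_val (Ordinal lt_i)); rewrite /vnum enum_valK.
Qed.

Lemma adjnE (x y : G) : adjn G (vnum x) (vnum y) = adj x y.
Proof.
apply/existsP/idP => [[x' /existsP[y' /and3P[xy /eqP Ex /eqP Ey]]]|xy].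
  by rewrite -(vnum_inj Ex) -(vnum_inj Ey).
by exists x; apply/existsP; exists y; rewrite xy !eqxx.
Qed.

Lemma runs_make_room (r : G -> nat) u st :
  nums st 4 0 = vnum u -> (forall y, nums st 1 (vnum y) = r y) ->
  runsG (#|G| * 5 + 3) make_room
    (fun st' => (forall y, nums st' 1 (vnum y) = r y + (r u < r y)) /\
       (forall k i, k != 1 -> k != 6 -> nums st' k i = nums st k i)) st.
Proof.
move=> st_u st_r.
(* Exactly the vertices numbered below [i] have been treated. *)
apply: (runs_for (T := 2) (I := fun i st' =>
  (forall y, nums st' 1 (vnum y) = r y + ((vnum y < i) && (r u < r y))) /\
  (forall k i, k != 1 -> k != 6 -> nums st' k i = nums st k i))).
- split=> [y|k i _ /negPf k6]; last by rewrite /= /upd k6.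
  by rewrite /= /upd /= st_r addn0.
- move=> i st' lt_i st'_i [st'_r frame].
  have [x Ex] := vnum_surj lt_i.
  have room b : b = (r u < r x) -> forall st'',
      (forall y, nums st'' 1 (vnum y) =
         if y == x then r x + b else nums st' 1 (vnum y)) ->
      (forall k i, k != 1 -> nums st'' k i = nums st' k i) ->
      nums st'' 6 0 = i /\
      ((forall y, nums (put_num st'' 6 0 i.+1) 1 (vnum y) =
          r y + ((vnum y < i.+1) && (r u < r y))) /\
       (forall k j, k != 1 -> k != 6 ->
          nums (put_num st'' 6 0 i.+1) k j = nums st k j)).
    move=> -> st'' st''1 st''k; split; first by rewrite st''k.
    split=> [y|k j k1 k6]; last first.
      by rewrite /= /upd (negPf k6) /= st''k // frame.
    rewrite /= /upd /= st''1; case: eqP => [->|/eqP neq_yx].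
      by rewrite Ex leqnn.
    have /negPf neq_i : vnum y != i by rewrite -Ex (inj_eq vnum_inj).
    by rewrite st'_r [vnum y < i.+1]ltnS [vnum y <= i]leq_eqVlt neq_i.
  (* The rank of [u] never moves, as [r u < r u] fails, and that of [x] has not moved yet: the test
     compares the original ranks. *)
  apply: runs_if; rewrite /= st'_i (frame 4) // st_u -Ex !st'_r Ex !ltnn addn0.
    move=> ru; apply: runs_put; apply: (room true); first by lia.
      move=> y; rewrite /= /upd /= st'_i -Ex (inj_eq vnum_inj).
      by case: eqP => // _; rewrite st'_r Ex ltnn addn0.
    by move=> k j /negPf k1; rewrite /= /upd k1.
  rewrite andbF addn0 => ru; apply: runs_skip; apply: (room false) => //.
    by lia.
  by move=> y; case: eqP => // ->; rewrite st'_r Ex ltnn !addn0.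
- move=> st' [st'_r frame]; split=> // y; by rewrite st'_r vnum_lt.
Qed.

(** Counting only the cut edges inside [s], instead of all of [cut l], makes the bound inductive
    under insertion. *)
Definition cheap_order s : Prop :=
  uniq s /\ changes l s <= #|[set e in cut l | e \subset s]|.*2.

Definition placed s st : Prop :=
  [/\ cheap_order s, forall y, nums st 1 (vnum y) = rank s y
    & forall i, nums st 2 i = 0].

(** Since [w] is new, the edge [uw] lies inside the enlarged order but not the old one; if cut, it
    pays for the two new changes. *)
Lemma cheap_order_insert s1 u w s2 :
  cheap_order (s1 ++ u :: s2) -> w \notin s1 ++ u :: s2 -> adj u w ->
  cheap_order (s1 ++ u :: w :: s2).
Proof.
move=> [Us chg] Nw uw; split.
  have -> : s1 ++ u :: w :: s2 = (s1 ++ [:: u]) ++ w :: s2 by rewrite -catA.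
  by rewrite uniq_catC cat_cons cons_uniq mem_cat orbC -mem_cat uniq_catC
             -catA Nw.
apply: leq_trans (changes_insert _ _ _ _ _) _.
apply: leq_trans (leq_add chg (leqnn _)) _.
rewrite -doubleD leq_double.
set E := [set e in cut l | _]; set E' := [set e in cut l | _].
have sE : E \subset E'.
  apply/subsetP=> e; rewrite !inE => /andP[-> /subsetP es] /=.
  apply/subsetP=> y /es; rewrite !mem_cat !inE.
  by case/or3P=> ->; rewrite ?orbT.
case: eqP => [_|/eqP luw] /=; first by rewrite addn0 subset_leq_card.
have NE : [set u; w] \notin E.
  rewrite inE negb_and; apply/orP; right; apply/negP=> /subsetP/(_ w).
  by rewrite !inE eqxx orbT => /(_ isT); apply/negP.
have <- : #|[set u; w] |: E| = #|E| + true by rewrite cardsU1 NE addnC.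
apply: subset_leq_card; rewrite subUset sE andbT sub1set inE.
apply/andP; split; first by apply/imsetP; exists (u, w); rewrite // inE /= uw.
by apply/subsetP=> y /set2P[] ->; rewrite !mem_cat !inE eqxx ?orbT.
Qed.

Lemma placed_put s st (k i a : nat) :
  k != 1 -> k != 2 -> placed s st -> placed s (put_num st k i a).
Proof.
rewrite ![k == _]eq_sym => /negPf k1 /negPf k2 [cheap st1 st2].
by split=> // [y|j]; rewrite /= /upd ?k1 ?k2 /=.
Qed.

Lemma runs_try_insert s u w st :
  placed s st -> nums st 4 0 = vnum u -> nums st 5 0 = vnum w ->
  runsG (#|G| * 5 + 8) try_insert
    (fun st' => exists s', [/\ placed s' st', {subset s <= s'},
       adj u w -> u \in s -> w \in s'
       & forall k, 2 < k < 6 -> nums st' k 0 = nums st k 0]) st.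
Proof.
move=> pl stu stw; have [cheap st1 st2] := pl.
(* [N] is the cost of an insertion; the three nested tests add 3. *)
pose N := #|G| * 5 + 5.
apply: (@runs_leq _ _ _ N.+3); first by rewrite /N; lia.
have skip : (adj u w -> u \in s -> w \in s) ->
    runsG N CSkip
    (fun st' => exists s', [/\ placed s' st', {subset s <= s'},
       adj u w -> u \in s -> w \in s'
       & forall k, 2 < k < 6 -> nums st' k 0 = nums st k 0]) st.
  move=> Huw; apply: (@runs_leq _ _ _ 1); first by rewrite /N; lia.
  by apply: runs_skip; exists s; split.
apply: runs_if; rewrite /= stu stw adjnE; last first.
  move=> Nuw; apply: runs_leq (skip _); first by lia.
  by move=> uw; rewrite uw in Nuw.
move=> uw'; have uw : adj u w by case: (adj u w) uw'.
apply: runs_if; rewrite /= stu st1 -?lt0n ?rank_gt0; last first.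
  move=> Nu; apply: runs_leq (skip _); first by lia.
  by rewrite -rank_gt0 Nu.
move=> us; apply: runs_if; rewrite /= stw st1 -?lt0n ?rank_gt0.
  by move=> ws; apply: skip.
move=> Nw'; have Nw : w \notin s by rewrite -rank_gt0 Nw'.
apply: (@runs_leq _ _ _ (#|G| * 5 + 3 + 1).+1); first by rewrite /N; lia.
apply: runs_seq; apply: runs_mono (runs_make_room stu st1) (leqnn _) _.
move=> st' [st'1 frame]; apply: runs_put.
case/splitPr: us st1 cheap Nw {pl skip Nw' st'1} (st'1) =>
  s1 s2 st1 cheap Nw st'1.
exists (s1 ++ u :: w :: s2); split.
- split; first exact: cheap_order_insert.
    move=> y; rewrite (rank_insert _ cheap.1 Nw) /= /upd /=.
    rewrite (frame 4) // (frame 5) // stu stw (inj_eq vnum_inj) !st'1.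
    by rewrite ltnn addn0 addn1.
  by move=> i; rewrite /= /upd /= frame // st2.
- by move=> y; rewrite !mem_cat !inE => /or3P[] ->; rewrite ?orbT.
- by rewrite !mem_cat !inE !eqxx !orbT.
- by move=> [|[|[|[|[|[|k]]]]]] //= _; rewrite /upd /= frame.
Qed.

Lemma runs_sweep s st : placed s st ->
  runsG (#|G| * (#|G| * (#|G| * 5 + 11) + 6) + 3) sweep
    (fun st' => nums st' 3 0 = nums st 3 0 /\
       exists s', [/\ placed s' st', {subset s <= s'} &
         forall u w, u \in s -> adj u w -> w \in s']) st.
Proof.
move=> pl.
rewrite (_ : 6 = 3 + 3) // addnA.
(* Here [u] ranges over the order [s] at the start of the sweep; nothing is claimed about neighbours
   of vertices inserted meanwhile. *)
apply: (runs_for (I := fun i st' => nums st' 3 0 = nums st 3 0 /\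
  exists s', [/\ placed s' st', {subset s <= s'} &
    forall u w, vnum u < i -> u \in s -> adj u w -> w \in s'])).
- by split=> //; exists s; split=> //; apply: placed_put.
- move=> i st1 lt_i st1_i [st1_3 [s1 [pl1 sub1 adj1]]].
  have [u Eu] := vnum_surj lt_i.
  rewrite (_ : 11 = 8 + 3) // addnA.
  apply: (runs_for (I := fun j st' =>
    [/\ nums st' 3 0 = nums st 3 0, nums st' 4 0 = i &
    exists s', [/\ placed s' st', {subset s1 <= s'} &
      forall w, vnum w < j -> u \in s -> adj u w -> w \in s']])).
  + by split=> //; exists s1; split=> //; apply: placed_put.
  + move=> j st2 lt_j st2_j [st2_3 st2_4 [s2 [pl2 sub2 adj2]]].
    have [w Ew] := vnum_surj lt_j.
    apply: (runs_mono (runs_try_insert (u := u) (w := w) pl2 _ _) (leqnn _)).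
      by rewrite st2_4.
      by rewrite st2_j.
    move=> st3 [s3 [pl3 sub3 adj3 frame]].
    rewrite !frame //; split=> //; split; rewrite /= /upd /= ?frame //.
    exists s3; split; first exact: placed_put.
      by move=> y /sub2/sub3.
    move=> w'; rewrite ltnS leq_eqVlt => /predU1P[Ew'|lt_w'] us uw.
      have Eww : w' = w by apply: vnum_inj; rewrite Ew.
      by rewrite Eww in uw *; apply: adj3 => //; apply/sub2/sub1.
    by apply/sub3/(adj2 w').
  + move=> st2 [st2_3 st2_4 [s2 [pl2 sub2 adj2]]]; split=> //.
    split=> //; exists s2; split; first exact: placed_put.
      by move=> y /sub1/sub2.
    move=> u' w'; rewrite ltnS leq_eqVlt => /predU1P[Eu'|lt_u'] us uw.
      have Euu : u' = u by apply: vnum_inj; rewrite Eu.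
      rewrite Euu in us uw.
      by apply: adj2 => //; apply: vnum_lt.
    by apply/sub2/(adj1 u').
- move=> st' [st'_3 [s' [pl' sub' adj']]]; split=> //; exists s'; split=> //.
  by move=> u w; apply: adj'; apply: vnum_lt.
Qed.

Definition linear_order s st : Prop :=
  [/\ uniq s, forall x, x \in s &
      forall x, nums st 1 (vnum x) = (index x s).+1].

(** If nothing is gained, [s'] has the members of [s] and is closed under adjacency, hence contains
    every vertex by connectedness. *)
Lemma sweep_grows s s' : connected_graph G -> 0 < size s -> uniq s -> uniq s' ->
  {subset s <= s'} -> (forall u w, u \in s -> adj u w -> w \in s') ->
  minn #|G| (size s).+1 <= size s'.
Proof.
move=> conn s_gt0 Us Us' sub adj'.
have [le_s|lt_s] := leqP (size s') (size s); last by lia.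
have [_ Es] := uniq_min_size Us sub le_s.
have adj_closed : closed (@adj G) s'.
  apply: intro_closed => [|u w uw us']; first exact/sym_connect_sym/adj_sym.
  by apply: adj' uw; rewrite Es.
case: s s_gt0 sub {le_s Us adj'} Es => // x s _ sub Es.
have all_s' y : y \in s'.
  have := closed_connect adj_closed (conn x y).
  by rewrite (sub x (mem_head _ _)) => <-.
rewrite cardE; apply: leq_trans (geq_minl _ _) _.
by apply: uniq_leq_size => [|y _]; [apply: enum_uniq | apply: all_s'].
Qed.

Lemma runs_build_order (l0 : L) : connected_graph G ->
  runsG (#|G| * (#|G| * (#|G| * (#|G| * 5 + 11) + 6) + 6) + 5) build_order
    (fun st => exists s, [/\ linear_order s st, changes l s <= #|cut l|.*2
       & forall i, nums st 2 i = 0]) (initial_store l0).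
Proof.
move=> conn; set T := #|G| * (#|G| * (#|G| * 5 + 11) + 6).
apply: (@runs_leq _ _ _ (1 + (#|G| * (T + 3 + 3) + 3)).+1); first by lia.
apply: runs_seq; apply: runs_put.
(* After [k] sweeps, [k.+1] vertices or all of them are placed; the minimum also allows for an empty
   graph, where [take 1] is empty. *)
apply: (runs_for (I := fun k st =>
  exists s, placed s st /\ minn #|G| k.+1 <= size s)).
- exists (take 1 (enum G)); split; last by rewrite size_take_min -cardE minnC.
  apply: placed_put => //; split=> // [|y].
    split; first by rewrite take_uniq ?enum_uniq.
    by case: (enum G) => [|x s] //=; rewrite take0.
  have [z z0] := vnum_surj (leq_ltn_trans (leq0n _) (vnum_lt y)).
  have Ez : nth z (enum G) 0 = z by rewrite -z0 nth_enum_rank.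
  rewrite /= /upd /= -z0 (inj_eq vnum_inj).
  have : y \in enum G by rewrite mem_enum.
  case: (enum G) Ez => //= x s -> _.
  by rewrite /rank /= z0 take0 inE /= (eq_sym z); case: (y == z).
- move=> k st lt_k st_k [s [pl le_s]].
  apply: runs_mono (runs_sweep pl) (leqnn _) _.
  move=> st' [st'_3 [s' [pl' sub adj']]]; rewrite st'_3; split=> //.
  exists s'; split; first exact: placed_put.
  have [[[Us _] _ _] [[Us' _] _ _]] := (pl, pl').
  by have := sweep_grows conn _ Us Us' sub adj'; lia.
- move=> st [s [[[Us chg] st1 st2] le_s]]; exists s.
  have all_s x : x \in s.
    have [||_ ->] := uniq_min_size Us (s2 := enum G); rewrite ?mem_enum //.
      by move=> y; rewrite mem_enum.
    by rewrite -cardE; move: le_s; rewrite (minn_idPl (leqnSn _)).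
  split=> //; first by split=> // x; rewrite st1 /rank all_s.
  apply: leq_trans chg _; rewrite leq_double subset_leq_card //.
  by apply/subsetP=> e; rewrite inE => /andP[].
Qed.

(** * Predicting and recording labels *)

Definition remembers (vs : seq G) st : Prop :=
  (forall x, nums st 2 (vnum x) = (x \in vs)) /\
  (forall x, x \in vs -> labs st 2 (vnum x) = l x).

Lemma runs_nearest_label s vs v st :
  linear_order s st -> remembers vs st -> nums st 0 0 = vnum v ->
  runsG (#|G| * 8 + 5) nearest_label
    (fun st' => [/\ linear_order s st', remembers vs st',
       nums st' 0 0 = vnum v &
       vs != [::] -> exists x, [/\ x \in vs, prediction st' = l x &
         forall y, y \in vs ->
           gap (index^~ s) v x <= gap (index^~ s) v y]]) st.
Proof.
rewrite /linear_order /remembers.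
move=> [Us all_s st1] [st2 stl] st_v.
have size_s := size_full_uniq Us all_s.
have gap_lt x : gap (index^~ s) v x < #|G|.
  have := index_mem x s; have := index_mem v s; rewrite !all_s size_s /gap; lia.
apply: (@runs_leq _ _ _ (1 + (#|G| * (5 + 3) + 3)).+1); first by lia.
apply: runs_seq; apply: runs_put.
(* Cell 7 holds [|V|] until a queried vertex is met, then the distance of the one whose label is the
   current prediction. *)
apply: (runs_for (I := fun i st' =>
  [/\ [/\ nums st' 1 =1 nums st 1, nums st' 2 =1 nums st 2,
      labs st' 2 =1 labs st 2 & nums st' 0 0 = vnum v],
      nums st' 7 0 = #|G| \/ (exists x, [/\ x \in vs, prediction st' = l x &
        nums st' 7 0 = gap (index^~ s) v x])
    & forall y, vnum y < i -> y \in vs ->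
        nums st' 7 0 <= gap (index^~ s) v y])).
- by split=> //; left.
- move=> i st' lt_i st'_i [[e1 e2 el e0] best near].
  have [x Ex] := vnum_surj lt_i.
  (* Ranks exceed indices by one, which cancels in the differences. *)
  have dist : eval #|G| (adjn G) st' distance = gap (index^~ s) v x.
    by rewrite /= st'_i e0 -Ex !e1 !st1 /gap !subSS.
  have near_step st'' : nums st'' 7 0 <= nums st' 7 0 ->
      (x \in vs -> nums st'' 7 0 <= gap (index^~ s) v x) ->
      forall y, vnum y < i.+1 -> y \in vs ->
        nums st'' 7 0 <= gap (index^~ s) v y.
    move=> le7 lex y; rewrite ltnS leq_eqVlt => /predU1P[Ey|lt_y] yvs.
      have Eyx : y = x by apply: vnum_inj; rewrite Ex.
      by rewrite Eyx in yvs *; apply: lex.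
    exact: leq_trans le7 (near _ lt_y yvs).
  have skip T : 0 < T -> (x \in vs -> nums st' 7 0 <= gap (index^~ s) v x) ->
      runsG T CSkip (fun st'' => nums st'' 6 0 = i /\
       [/\ [/\ nums (put_num st'' 6 0 i.+1) 1 =1 nums st 1,
          nums (put_num st'' 6 0 i.+1) 2 =1 nums st 2,
          labs (put_num st'' 6 0 i.+1) 2 =1 labs st 2
          & nums (put_num st'' 6 0 i.+1) 0 0 = vnum v],
        nums (put_num st'' 6 0 i.+1) 7 0 = #|G| \/
        (exists x, [/\ x \in vs,
          prediction (put_num st'' 6 0 i.+1) = l x &
          nums (put_num st'' 6 0 i.+1) 7 0 = gap (index^~ s) v x])
      & forall y, vnum y < i.+1 -> y \in vs ->
          nums (put_num st'' 6 0 i.+1) 7 0 <= gap (index^~ s) v y]) st'.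
    move=> T_gt0 le_x; apply: runs_leq T_gt0 _; apply: runs_skip.
    by split=> //; split=> //; apply: near_step.
  apply: runs_if; rewrite [eval _ _ _ _]/= st'_i e2 -Ex st2 => xvs; last first.
    by rewrite Ex; apply: skip => // xvs'; rewrite xvs' in xvs.
  have {}xvs : x \in vs by case: (x \in vs) xvs.
  have test : eval #|G| (adjn G) st' (ESub (cell 7) distance) =
      nums st' 7 0 - gap (index^~ s) v x by rewrite -dist.
  apply: runs_if; rewrite test => lt_x; last first.
    by rewrite Ex; apply: skip => // _; lia.
  apply: (@runs_leq _ _ _ (1 + 1).+1) => //.
  apply: runs_seq; apply: runs_put; rewrite dist; apply: runs_copy.
  rewrite /= /upd /= st'_i -Ex; split=> //; split=> //.
    by right; exists x; split=> //; rewrite /prediction /= /upd /= el stl.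
  rewrite Ex.
  apply: (near_step (put_num st' 7 0 (gap (index^~ s) v x))) => //.
  by rewrite /= /upd /= ltnW // -subn_gt0 lt0n.
- move=> st' [[e1 e2 el e0] best near]; split=> //.
  + by split=> // x; rewrite e1.
  + by split=> x; rewrite ?e2 ?el //; apply: stl.
  + case: vs {st2 stl} best near => // y0 vs best near _.
    (* With a queried vertex [y0] at distance below [|V|], cell 7 cannot have kept its initial
       value. *)
    case: best => [best|[x [xvs px bx]]].
      have := near y0 (vnum_lt _) (mem_head _ _).
      by rewrite best leqNgt gap_lt.
    exists x; split=> // y; rewrite -bx; apply: near; exact: vnum_lt.
Qed.

Lemma runs_record_label s vs v st :
  linear_order s st -> remembers vs st -> nums st 0 0 = vnum v ->
  labs st 0 0 = l v ->
  runsG 3 record_label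
    (fun st' => linear_order s st' /\ remembers (rcons vs v) st') st.
Proof.
move=> [Us all_s st1] [st2 stl] st_v st_l.
apply: (@runs_seq _ _ _ 1 1); apply: runs_copy; apply: runs_put.
split; first by split.
split=> x; rewrite /= /upd /= st_v (inj_eq vnum_inj) mem_rcons inE.
  by case: eqP => //=; rewrite st2.
by case: eqP => [->|] //= _; apply: stl.
Qed.

End Correctness.

(** * Sessions *)

Lemma mistakes_rcons (G : sgraph) (L : eqType) (l : G -> L) vs ys v y :
  size ys = size vs -> vs != [::] ->
  mistakes l (rcons vs v) (rcons ys y) = mistakes l vs ys + (y != l v).
Proof.
case: vs ys => [|x vs] [|z ys] // [Esz] _.
rewrite /mistakes map_rcons /= zip_rcons ?size_map // -cats1 count_cat /=.
by rewrite addn0.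
Qed.

(** The time of [build_order], its linear coefficient raised from 6 to 8 to cover the [8n + 5] of a
    prediction. *)
Definition time_bound : {poly nat} := Poly [:: 5; 8; 6; 11; 5].

Lemma time_boundE n : time_bound.[n]%R =
  n * (n * (n * (n * 5 + 11) + 6) + 8) + 5.
Proof.
rewrite horner_Poly /= GRing.mul0r GRing.add0r.
rewrite -![(_ * _)%R]/(muln _ _) -![(_ + _)%R]/(addn _ _); lia.
Qed.

Lemma nearest_neighbour_session (G : sgraph) (L : eqType) (l0 : L) (l : G -> L)
    vs : connected_graph G ->
  exists ys st, session nearest_neighbour l0 l time_bound.[#|G|]%R vs ys st /\
    mistakes l vs ys <= #|cut l|.*2 * trunc_log 2 #|G|.*2.
Proof.
move=> conn; set B := time_bound.[_]%R.
(* The order [s] built by [init] and the charges are carried through the rounds. *)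
suff [ys [st [s [ses sz [[Us all_s st1] chg _] chd]]]] : exists ys st s,
    [/\ session nearest_neighbour l0 l B vs ys st, size ys = size vs,
        [/\ linear_order s st, changes l s <= #|cut l|.*2 & remembers l vs st]
      & charged #|G| (index^~ s) (nth l0 (map l s)) vs (mistakes l vs ys)].
  exists ys, st; split=> //; apply: leq_trans (charged_bound chd) _.
  rewrite leq_mul2r; apply/orP; right; apply: leq_trans chg.
  by rewrite (changesE l l0) (size_full_uniq Us all_s).
elim/last_ind: vs => [|vs v [ys [st [s [ses sz [lin chg rem] chd]]]]].
  have [] := runs_halts (B := B) _ (runs_build_order l l0 conn).
    by rewrite /B time_boundE; nia.
  move=> st run [s [lin chg st2]]; exists [::], st, s; split=> //.
    exact: session_init.
  exact: charged_start.
have [Us all_s _] := lin.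
have size_s := size_full_uniq Us all_s.
have fE x : nth l0 (map l s) (index x s) = l x.
  by rewrite (nth_map x) ?index_mem // nth_index.
have [] := runs_halts (B := B) _
  (runs_nearest_label (v := v) (st := ask v st) lin rem _).
- by rewrite /B time_boundE; nia.
- by rewrite /= /upd.
move=> st1 run1 [lin1 rem1 st1_v near].
have [] := runs_halts (B := B) _
  (runs_record_label (v := v) (st := reveal (l v) st1) lin1 rem1 st1_v _).
- by rewrite /B time_boundE; nia.
- by rewrite /= /upd.
move=> st2 run2 [lin2 rem2].
exists (rcons ys (prediction st1)), st2, s; split.
- exact: session_round ses run1 run2.
- by rewrite !size_rcons sz.
- by [].
have sub : {subset vs <= rcons vs v}.
  by move=> x xvs; rewrite mem_rcons inE xvs orbT.
(* The first round has no nearest vertex, but its mistake is not counted. *)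
have [vs0|vs_neq0] := eqVneq vs [::].
  rewrite vs0 in sz *; rewrite (size0nil sz).
  exact: charged_start.
rewrite mistakes_rcons //.
have [x [xvs -> x_near]] := near vs_neq0.
have [_|lx] := eqVneq (l x) (l v).
  by rewrite addn0; apply: charged_sub chd.
rewrite addn1; apply: charged_mistake xvs x_near _ chd => //.
- by move=> y; rewrite -size_s index_mem.
- by rewrite mem_rcons mem_head.
- by rewrite !fE.
Qed.

(** * From binary to natural logarithms *)

Import Order.TTheory GRing.Theory Num.Theory.
Local Open Scope ring_scope.

(** For [n >= 2], the power of 2 is at most [2n <= n ^ 2]. *)
Lemma ln_trunc_log_double (R : realType) (n : nat) : (1 < n)%N ->
  (trunc_log 2 n.*2)%:R * ln 2 <= 2 * ln n%:R :> R.
Proof.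
move=> n_gt1.
have n_gt0 : 0 < n%:R :> R by rewrite ltr0n; lia.
rewrite mulr_natl -lnXn // [leRHS]mulr_natl -lnXn //.
rewrite ler_ln ?posrE ?exprn_gt0 // -!natrX ler_nat.
have := @trunc_logP 2 n.*2 isT; rewrite double_gt0.
by move=> /(_ (ltnW n_gt1)); nia.
Qed.

Theorem theorem3 (R : realType) :
  exists C : R, 0 < C /\
  exists A : algorithm, polynomial_time A /\
  forall G : sgraph, connected_graph G ->
  forall (L : eqType) (l0 : L) (l : G -> L) (vs : seq G) (ys : seq L),
    answers A l0 l vs ys ->
    (mistakes l vs ys)%:R <= C * ln (#|G|%:R) * #|cut l|%:R.
Proof.
have ln2_gt0 : 0 < ln 2 :> R by rewrite ln_gt0 // ltr1n.
(* One factor 2 comes from the changes per cut edge, the other from [2n <= n ^ 2]. *)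
exists (4 / ln 2); split; first by rewrite divr_gt0.
exists nearest_neighbour; split.
  exists time_bound => G conn L l0 l vs.
  by have [ys [st [ses _]]] := nearest_neighbour_session l0 l vs conn;
     exists ys, st.
move=> G conn L l0 l vs ys [B [st ses]].
have [ys' [st' [ses' le_m]]] := nearest_neighbour_session l0 l vs conn.
have [Eys _] := session_inj ses ses'; rewrite -{}Eys in le_m.
(* With at most one vertex there is no edge, so both sides vanish. *)
have [le_G1|G_gt1] := leqP #|G| 1.
  have cut0 : cut l = set0.
    apply/setP=> e; rewrite inE; apply/negbTE/imsetP => -[[x y]].
    rewrite inE /= => /andP[_]; have /fintype_le1P/(_ x y) -> := le_G1.
    by rewrite eqxx.
  by move: le_m; rewrite cut0 cards0 mulr0 leqn0 => /eqP ->.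
apply: (@le_trans _ _ (#|cut l|.*2 * trunc_log 2 #|G|.*2)%:R).
  by rewrite ler_nat.
rewrite -muln2 !natrM -(ler_pM2r ln2_gt0) -[leLHS]mulrA.
rewrite [leRHS](_ : _ = #|cut l|%:R * 2 * (2 * ln #|G|%:R)); last first.
  by field; rewrite gt_eqF.
by apply: ler_wpM2l; [rewrite mulr_ge0 | apply: ln_trunc_log_double].
Qed.
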